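(* Suppose $\kappa$ is a regular, uncountable cardinal and $\boxtimes(\kappa)$ holds. Then $\mathrm{Refl}(S^\kappa_\omega)$ fails.
   Context: For a set of ordinals $A$, $\mathrm{acc}(A) = \{\beta \in A \setminus \{0\} \mid \sup(A \cap \beta) = \beta\}$. A club in an ordinal $\alpha$ is a closed and cofinal subset of $\alpha$. For a set of ordinals $D$, $\mathrm{succ}_\omega(D) = \{\delta \in D \mid \text{for some } j < \omega,\ \mathrm{otp}(D \cap \delta) = j+1\}$. For $\kappa$ regular uncountable, $\boxtimes(\kappa)$ asserts that there is a sequence $\langle C_\alpha \mid \alpha < \kappa \rangle$ such that: (i) for all $\alpha < \kappa$, $C_\alpha$ is a club in $\alpha$; (ii) for all $\alpha < \beta < \kappa$, if $\alpha \in \mathrm{acc}(C_\beta)$, then $C_\beta \cap \alpha = C_\alpha$; (iii) for every sequence $\langle A_i \mid i < \kappa \rangle$ of cofinal subsets of $\kappa$, there is a nonzero $\beta < \kappa$ such that, for all $i < \beta$, $\sup(\{\alpha < \beta \mid \mathrm{succ}_\omega(C_\beta \setminus \alpha) \subseteq A_i\}) = \beta$. $S^\kappa_\omega = \{\beta < \kappa \mid \mathrm{cf}(\beta) = \omega\}$. For $S \subseteq \kappa$ stationary, $S$ reflects if there is $\alpha < \kappa$ of uncountable cofinality such that $S \cap \alpha$ is stationary in $\alpha$. $\mathrm{Refl}(S)$ asserts that every stationary $T \subseteq S$ reflects. *)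

(* Defs.v *)
From mathcomp Require Import all_boot all_order.
From mathcomp Require Import boolp wochoice classical_sets functions cardinality.

Set Implicit Arguments.
Unset Strict Implicit.
Unset Printing Implicit Defensive.

Local Open Scope order_scope.
Local Open Scope classical_set_scope.

(* An ordinal kappa is represented by a well-ordered type K.  The elements of
   K are the ordinals below kappa.  As with von Neumann ordinals, an ordinal
   a < kappa is also the set [below a] of its predecessors and kappa itself is
   the set [setT], so the notions that make sense for all ordinals <= kappa
   take an initial segment of K as argument. *)

(* otp(A) = otp(B).  The map is total, so this is meant for an inhabited T'
   (below, nat or the uncountable K). *)
Definition same_otp {d d' : Order.disp_t} {T : orderType d} {T' : orderType d'}
    (A : set T) (B : set T') : Prop :=
  exists f : T -> T', set_bij A B f /\ {in A &, {mono f : x y / x < y}}.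

Section Ordinals.
Context {d : Order.disp_t} {K : orderType d}.
Implicit Types (a b : K) (A C D S T X Y : set K).

Definition below a : set K := [set x | x < a].

Definition nonzero a : Prop := exists x, x < a.

Definition initial_segment X : Prop := forall x y, X y -> x < y -> X x.

(* [isLub] reads the supremum of the empty set as 0, whence [nonzero]. *)
Definition acc A : set K :=
  [set b | [/\ A b, nonzero b & isLub (A `&` below b) b]].

(* The inequality is weak: a cofinal subset of a successor ordinal contains its
   maximum. *)
Definition cofinal A S : Prop :=
  A `<=` S /\ forall x, S x -> exists2 y, A y & x <= y.

Definition closed_in C S : Prop :=
  forall b, S b -> nonzero b -> isLub (C `&` below b) b -> C b.

Definition club C S : Prop := cofinal C S /\ closed_in C S.

Definition stationary T S : Prop :=
  T `<=` S /\ forall C, club C S -> T `&` C !=set0.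

Definition succ_omega D : set K :=
  [set e | D e /\ exists j : nat, same_otp (D `&` below e) `I_j.+1].

(* cf(S) = X: the ordinal X is the least order type of a cofinal subset of S. *)
Definition is_cf S X : Prop :=
  [/\ initial_segment X,
      exists2 A, cofinal A S & same_otp A X
    & forall A Y, cofinal A S -> initial_segment Y -> same_otp A Y -> X `<=` Y].

Definition cf_omega b : Prop :=
  exists2 X, is_cf (below b) X & same_otp X [set: nat].

Definition cf_uncountable b : Prop :=
  exists2 X, is_cf (below b) X & ~ countable X.

Definition reflects S : Prop :=
  exists2 a, cf_uncountable a & stationary (S `&` below a) (below a).

Definition Refl S : Prop :=
  forall T, T `<=` S -> stationary T [set: K] -> reflects T.

End Ordinals.

Definition S_omega {d : Order.disp_t} (K : orderType d) : set K :=
  [set b | cf_omega b].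
Arguments S_omega {d} K _.

Record regular_uncountable_cardinal {d : Order.disp_t} (K : orderType d) : Prop := {
  ruc_well_order : well_order (<=%O : rel K);
  ruc_cardinal : forall a : K, ~ ([set: K] #<= below a)%card;
  ruc_uncountable : ~ countable [set: K];
  ruc_regular : is_cf [set: K] [set: K]
}.

Definition boxtimes_seq {d : Order.disp_t} (K : orderType d) (C : K -> set K) : Prop :=
  [/\ forall a, club (C a) (below a),
      forall a b, a < b -> acc (C b) a -> C b `&` below a = C a
    & forall A : K -> set K, (forall i, cofinal (A i) [set: K]) ->
      exists2 b, nonzero b & forall i, i < b ->
        isLub [set a | a < b /\ succ_omega (C b `\` below a) `<=` A i] b].

Definition boxtimes {d : Order.disp_t} (K : orderType d) : Prop :=
  exists C : K -> set K, boxtimes_seq C.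

(* Main.v *)
Require Import Defs.
From mathcomp Require Import all_boot all_order.
From mathcomp Require Import boolp classical_sets.
From mathcomp Require Import wochoice functions cardinality.

Set Implicit Arguments.
Unset Strict Implicit.
Unset Printing Implicit Defensive.

Import Order.TTheory.

Local Open Scope order_scope.
Local Open Scope classical_set_scope.

(* Let T_e be the set of b of cofinality omega with e < b such that C_b has no
   accumulation point above e.  T_e does not reflect: at an a of uncountable
   cofinality, stationarity would give t < u in T_e that are accumulation
   points of C_a; then C_u extends C_t, so t is an accumulation point of C_u
   above e.  If Refl held, every T_e would thus miss a club E_e.  Apply (iii) to
   the diagonal intersection E of the E_e: for some b and some tail D of C_b
   the second, third, ... elements of D lie in E.  The supremum x of the first
   omega elements of D is then in E, and by coherence it is in T_e for
   e = min D < x, although x is in E_e. *)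

(** * Suprema and increasing sequences in a linear order *)

Section OrderFacts.
Context {d : Order.disp_t} {K : orderType d}.
Implicit Types (a b x y z : K) (A C D E S X Y : set K) (s : nat -> K).

Lemma isLub_belowP A b :
  isLub (A `&` below b) b <-> forall z, z < b -> exists2 x, A x & z < x < b.
Proof.
split=> [[_ least] z ltzb | H].
  apply: contrapT => nex; suff: b <= z by rewrite leNgt ltzb.
  apply: least => x [Ax ltxb]; rewrite leNgt; apply/negP => ltzx.
  by apply: nex; exists x; rewrite ?ltzx.
split=> [x [_ /ltW]// | u ubu]; rewrite leNgt; apply/negP => /H[x Ax /andP[ltux ltxb]].
by have := ubu x (conj Ax ltxb); rewrite leNgt ltux.
Qed.

Lemma initial_segment_below a : initial_segment (below a).
Proof. by move=> x y ya xy; apply: lt_trans ya. Qed.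

Lemma seq_mono_lt s : (forall n, s n < s n.+1) -> {mono s : m n / (m < n)%N >-> m < n}.
Proof. by move=> /(homo_ltn lt_trans) smono; apply/leW_mono/le_mono. Qed.

Lemma seq_same_otp s (A : set K) (B : set nat) :
  {mono s : m n / (m < n)%N >-> m < n} -> A = s @` B -> same_otp A B.
Proof.
move=> smono ->.
have sinj : injective s.
  by move=> m n e; case: (ltngtP m n) => //; rewrite -smono e ltxx.
pose f x := xget 0%N [set i | s i = x].
have fs i : f (s i) = i by rewrite /f; case: xgetP => [j _ /sinj|/(_ i)] //=.
exists f; split; [split|].
- by move=> _ [i Bi <-]; rewrite /= fs.
- by move=> x y /set_mem[i _ <-] /set_mem[j _ <-]; rewrite !fs => ->.
- by move=> i Bi; exists (s i); [exists i|].
- by move=> x y /set_mem[i _ <-] /set_mem[j _ <-]; rewrite !fs smono ltEnat.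
Qed.

(** Uncountable cofinality in the form used below: the empty [A] makes [S] nonempty, and singletons
    exclude a maximum. *)
Definition countably_directed S :=
  forall A, A `<=` S -> countable A -> exists2 x, S x & forall y, A y -> y < x.

End OrderFacts.

(** * Well-orders: collapse, cofinality, clubs and first omega elements *)

Section WellOrder.
Context {d : Order.disp_t} {K : orderType d} (woK : well_order (<=%O : rel K)).
Implicit Types (a b x y z : K) (A C D E S X Y : set K) (s : nat -> K).

Lemma exists_min A : A !=set0 -> exists2 m, A m & forall x, A x -> m <= x.
Proof.
move=> [x Ax].
have [|m [[/asboolP Am mle] _]] := woK (A := fun x => `[< A x >]).
  by exists x; apply/asboolP.
by exists m => // y Ay; apply: mle; apply/asboolP.
Qed.

Lemma lt_wf : well_founded (fun x y : K => x < y).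
Proof.
move=> x; apply: contrapT => nx.
have [m nm mle] := @exists_min [set x | ~ Acc (fun x y : K => x < y) x] (ex_intro _ x nx).
apply: nm; constructor => y ltym; apply: contrapT => /mle.
by rewrite leNgt ltym.
Qed.

(* Mostowski collapse: [c a] is the least strict upper bound of the values of
   [c] at the elements of [A] below [a]. *)
Lemma collapse A : exists2 c : K -> K,
  {in A &, {mono c : x y / x < y}} & initial_segment (c @` A).
Proof.
pose rk a (P : set K) := xget a [set z | P z /\ forall w, P w -> z <= w].
pose F a (rec : forall b, b < a -> K) := rk a [set z | forall b (h : b < a), A b -> rec b h < z].
pose c := Fix lt_wf (fun=> K) F.
have cE a : c a = rk a [set z | forall b, b < a -> A b -> c b < z].
  rewrite /c Fix_eq // => x f g fg.
  by congr (F x _); apply: functional_extensionality_dep => y;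
     apply: functional_extensionality_dep.
have cP a : (forall b, b < a -> A b -> c b < c a) /\
    forall w, (forall b, b < a -> A b -> c b < w) -> c a <= w.
  rewrite cE /rk.
  have [z Pz zle] : exists2 z, (forall b, b < a -> A b -> c b < z) &
      forall w, (forall b, b < a -> A b -> c b < w) -> z <= w.
    apply: (@exists_min [set z | forall b, b < a -> A b -> c b < z]).
    (* [a] is itself a strict upper bound, since [c b <= b < a] by induction; if no bound existed at
       [b], the default of [rk b] would give [c b = b]. *)
    exists a; elim/(well_founded_ind lt_wf): a => a IH b ltba Ab.
    apply: le_lt_trans (ltba); rewrite cE /rk; case: xgetP => [z _ [_ zle]|_] //.
    by apply: zle; apply: (IH b).
  case: xgetP => [y _ []|/(_ z)] // [].
  by split.
have cmono : {in A &, {homo c : x y / x < y}}.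
  by move=> x y /set_mem Ax _ ltxy; apply: (cP y).1.
exists c.
  by apply/leW_mono_in/le_mono_in.
move=> y _ [a Aa <-].
elim/(well_founded_ind lt_wf): a Aa => a IH Aa ltya.
(* Otherwise [y] would be a strict upper bound of these [c b], and [c a <= y] by leastness. *)
have [b [ltba Ab leyb]] : exists b, [/\ b < a, A b & y <= c b].
  apply: contrapT => nb; have : c a <= y; last by rewrite leNgt ltya.
  apply: (cP a).2 => b ltba Ab; rewrite ltNge; apply/negP => leyb.
  by apply: nb; exists b.
move: leyb; rewrite le_eqVlt => /orP[/eqP->|]; first by exists b.
exact: IH.
Qed.

Lemma mono_same_otp A (c : K -> K) :
  {in A &, {mono c : x y / x < y}} -> same_otp A (c @` A).
Proof.
move=> cmono; exists c; split=> //; split.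
- by move=> x Ax; exists x.
- by move=> x y Ax Ay e; case: (ltgtP x y) => //; rewrite -cmono // e ltxx.
- by move=> _ [x Ax <-]; exists x.
Qed.

(** Without a bound [A] is cofinal in [S]. Its collapse is an initial segment of the same order
    type, so it contains [X] by minimality, and [X] injects into [A]. *)
Lemma cf_bounded S X A : is_cf S X -> A `<=` S -> ~ (X #<= A)%card ->
  exists2 x, S x & forall y, A y -> y < x.
Proof.
move=> [_ _ minX] AS XA; apply: contrapT => nb; apply: XA.
have cofA : cofinal A S.
  split=> // x Sx; apply: contrapT => nex; apply: nb; exists x => // y Ay.
  by rewrite ltNge; apply/negP => lexy; apply: nex; exists y.
have [c cmono cini] := collapse A.
apply: card_le_trans (card_image_le c A).
by apply: subset_card_le; apply: (minX A) => //; apply: mono_same_otp.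
Qed.

Lemma cf_countably_directed S X :
  is_cf S X -> ~ countable X -> countably_directed S.
Proof.
move=> cfX ncX A AS cA; apply: cf_bounded cfX AS _ => XA.
by apply: ncX; apply: sub_countable cA.
Qed.

(** Take for [e] the supremum of the iterates of [g] at [x]; countable directedness keeps it in [S].
    Suitable choices of [g] make [e] a limit of prescribed sets. *)
Lemma closure_point S (g : K -> K) x : initial_segment S -> countably_directed S ->
  (forall y, S y -> S (g y) /\ y < g y) -> S x ->
  exists e, [/\ S e, x < e &
    forall z, z < e -> exists y, [/\ S y, z <= y & g y < e]].
Proof.
move=> iniS dirS Sg Sx; pose s n := iter n g x.
have Ss n : S (s n) by elim: n => //= n /Sg[].
have [|u0 Su0 su0] := dirS (range s) _ (card_image_le _ _).
  by move=> _ [n _ <-].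
have [|e [Se se] emin] := @exists_min [set u | S u /\ forall n, s n < u].
  by exists u0; split=> // n; apply: su0; exists n.
exists e; split=> // [|z ltze]; first exact: (se 0%N).
have [n lezn] : exists n, z <= s n.
  apply: contrapT => nex; suff: e <= z by rewrite leNgt ltze.
  apply: emin; split=> [|n]; first exact: iniS ltze.
  by rewrite ltNge; apply/negP => lez; apply: nex; exists n.
by exists (s n); split=> //; apply: (se n.+1).
Qed.

(** For cofinality, let [g] jump to a larger point of [C]: a closure point of [g] is then a limit of
    [C]. *)
Lemma club_acc S C y : initial_segment S -> countably_directed S -> club C S ->
  S y -> club (acc C `&` [set x | y < x]) S.
Proof.
move=> iniS dirS [[CS Ccof] Ccl] Sy; split; first split.
- by move=> x [[/CS]].
- move=> x Sx; pose m := Order.max x y.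
  have Sm : S m by rewrite /m; case: leP.
  have next z : exists w, S z -> C w /\ z < w.
    have [Sz|nSz] := pselect (S z); last by exists z.
    have [||u Su zu] := dirS [set z]; first by move=> _ ->.
      exact: countable1.
    have [w Cw leuw] := Ccof u Su.
    by exists w => _; split=> //; apply: lt_le_trans leuw; apply: zu.
  have [g gP] := boolp.choice next.
  have [z Sz|e [Se ltme eP]] := @closure_point S g m iniS dirS _ Sm.
    by have [Cg] := gP z Sz; split=> //; apply: CS.
  have lub : isLub (C `&` below e) e.
    apply/isLub_belowP => z /eP[w [Sw lezw ltge]]; have [Cg ltwg] := gP w Sw.
    by exists (g w) => //; rewrite ltge (le_lt_trans lezw).
  have ze : nonzero e by exists m.
  exists e; last by apply: ltW; apply: le_lt_trans ltme; rewrite le_max lexx.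
  split; last by apply: le_lt_trans ltme; rewrite le_max lexx orbT.
  by split=> //; apply: Ccl.
- move=> b Sb zb /isLub_belowP lub; have [z0 ltz0b] := zb.
  have [w [_ ltyw] /andP[_ ltwb]] := lub z0 ltz0b.
  have lubC : isLub (C `&` below b) b.
    by apply/isLub_belowP => z /lub[v [[Cv _ _] _] zvb]; exists v.
  split; last exact: lt_trans ltwb.
  by split=> //; apply: Ccl.
Qed.

(** For cofinality, take [g z] so large that each [E e] with [e <= z] has a point strictly between
    [z] and [g z]; the second hypothesis bounds these choices. A closure point [b] of [g] is then a
    limit of every [E e] with [e < b]. *)
Lemma club_diagonal (E : K -> set K) :
  countably_directed [set: K] ->
  (forall a A, (A #<= below a)%card -> exists x, forall y, A y -> y < x) ->
  (forall e, club (E e) [set: K]) ->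
  club [set b | forall e, e < b -> E e b] [set: K].
Proof.
move=> dirK bndK clubE.
have above z : exists w, z < w.
  have [||u _ zu] := dirK [set z] => //.
  by exists u; apply: zu.
split; first split=> // x _.
  have sel z e : exists v, E e v /\ z < v.
    have [w zw] := above z; have [v Ev lewv] := (clubE e).1.2 w I.
    by exists v; split=> //; apply: lt_le_trans lewv.
  have next z : exists w, z < w /\ forall e, e <= z -> exists2 v, E e v & z < v < w.
    have [f fP] := boolp.choice (sel z); have [u zu] := above z.
    have [w wP] := bndK u (f @` below u) (card_image_le _ _).
    exists w; split=> [|e lez].
      by apply: lt_trans (wP (f z) _); [have [] := fP z|exists z].
    exists (f e); [by have [] := fP e|]; rewrite (fP e).2 wP //.
    by exists e => //; apply: le_lt_trans zu.
  have [g gP] := boolp.choice next.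
  have [|y _||b [_ ltxb bP]] := @closure_point setT g x _ dirK => //.
    by have [] := gP y.
  exists b; last exact: ltW.
  move=> e lteb; apply: (clubE e).2 => //; first by exists x.
  apply/isLub_belowP => z ltzb; have ltm : Order.max e z < b by rewrite gt_max lteb.
  have [y [_ lemy ltgb]] := bP _ ltm; move: lemy; rewrite ge_max => /andP[ley lezy].
  have [v Ev /andP[ltyv ltvg]] := (gP y).2 e ley.
  by exists v => //; rewrite (le_lt_trans lezy) //= (lt_trans ltvg).
move=> b _ zb /isLub_belowP lub e lteb; apply: (clubE e).2 => //.
apply/isLub_belowP => z ltzb; have ltm : Order.max e z < b by rewrite gt_max lteb.
have [w Ew /andP[]] := lub _ ltm; rewrite gt_max => /andP[ltew ltzw] ltwb.
by exists w; [apply: Ew|rewrite ltzw].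
Qed.

(** Iterating the successor inside [D] from its minimum skips no element, so the range of [s] is an
    initial segment of [D]. *)
Lemma first_omega D : D !=set0 -> (forall x, D x -> exists2 y, D y & x < y) ->
  exists s, [/\ forall n, D (s n), forall n, s n < s n.+1
    & forall n w, D w -> w < s n -> exists2 m, (m < n)%N & w = s m].
Proof.
move=> nzD noMax; have [m0 Dm0 m0le] := exists_min nzD.
have next x : exists y, D x -> [/\ D y, x < y & forall w, D w -> x < w -> y <= w].
  have [Dx|nDx] := pselect (D x); last by exists x.
  have [y Dy ltxy] := noMax x Dx.
  have [|m [Dm ltxm] mle] := @exists_min [set y | D y /\ x < y]; first by exists y.
  by exists m => _; split=> // w Dw ltxw; apply: mle.
have [g gP] := boolp.choice next; pose s n := iter n g m0.
have Ds n : D (s n) by elim: n => //= n /gP[].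
exists s; split=> // [n|]; first by have [] := gP _ (Ds n).
elim=> [|n IH] w Dw.
  by move=> /(le_lt_trans (m0le w Dw)); rewrite ltxx.
have [_ _ lew] := gP _ (Ds n) => ltwS.
have [lew'|] := leP w (s n); last by move=> /(lew w Dw); rewrite leNgt ltwS.
move: lew'; rewrite le_eqVlt => /orP[/eqP->|/(IH w Dw)[m ltmn ->]]; first by exists n.
by exists m => //; apply: ltnW.
Qed.

(** The elements of [D] below [s n.+1] are [s 0], ..., [s n]. The index starts at 1 because [D] has
    order type 0, not a successor, below its minimum [s 0]. *)
Lemma succ_omega_first D s n :
    (forall n, D (s n)) -> (forall n, s n < s n.+1) ->
    (forall n w, D w -> w < s n -> exists2 m, (m < n)%N & w = s m) ->
  succ_omega D (s n.+1).
Proof.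
move=> Ds sS sP; have smono := seq_mono_lt sS.
split=> //; exists n; apply: (seq_same_otp smono).
apply/seteqP; split=> [w [Dw /(sP _ w Dw)[m ltm ->]]|_ [m ltm <-]]; first by exists m.
by split=> //; rewrite /below /= smono.
Qed.

(** The range of [s] is cofinal of type omega; it is collapsed to [t] because [is_cf] asks for an
    initial segment of [K]. *)
Lemma cf_omega_sup s b : (forall n, s n < s n.+1) -> (forall n, s n < b) ->
  (forall z, z < b -> exists n, z <= s n) -> cf_omega b.
Proof.
move=> sS sb cofs; have smono := seq_mono_lt sS.
have [c cmono cini] := collapse (range s).
pose t := c \o s.
have tmono : {mono t : m n / (m < n)%N >-> m < n}.
  by move=> m n; rewrite /t /= cmono ?smono //; apply/mem_set; [exists m|exists n].
have rt : c @` range s = range t by rewrite image_comp.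
rewrite rt in cini.
have otpt : same_otp (range t) [set: nat] by apply: seq_same_otp tmono _.
exists (range t) => //; split=> //.
  rewrite -rt; exists (range s); last exact: mono_same_otp.
  split=> [_ [n _ <-]|z /cofs[n len]]; first exact: sb.
  by exists (s n) => //; exists n.
move=> A Y [Ab Acof] iniY [f [[fY _ fsurj] fmono]] _ [n _ <-].
(* If [Y] missed [t n], it would consist of some [t m] with [m < n] and have a maximum [t i]. The
   element of [A] mapped to it would be the maximum of [A], but a cofinal subset of a limit has
   none. *)
apply: contrapT => nYn.
have Ylt y : Y y -> y < t n.
  move=> Yy; rewrite ltNge; apply/negP; rewrite le_eqVlt => /orP[/eqP e|ltn].
    by apply: nYn; rewrite e.
  by apply: nYn; apply: iniY ltn.
have Yt y : Y y -> exists2 m, (m < n)%N & y = t m.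
  move=> Yy; have := Ylt y Yy.
  have [m _ <-] : range t y by apply: (cini _ (t n)); [exists n|apply: Ylt].
  by rewrite tmono; exists m.
have [a0 Aa0 _] := Acof _ (sb 0%N).
have [m0 ltm0 fm0] := Yt _ (fY _ Aa0).
have [|i /asboolP lei|i /asboolP Yi imax] := @ex_maxnP (fun i => `[< Y (t i) >]) n.
- by exists m0; apply/asboolP; rewrite -fm0; apply: fY.
- by have := Ylt _ lei; rewrite tmono => /ltnW.
have [a Aa fa] := fsurj _ Yi.
have [k lek] := cofs a (Ab a Aa).
have [a' Aa' lea'] := Acof _ (sb k.+1).
have ltaa' : a < a' by rewrite (le_lt_trans lek) // (lt_le_trans _ lea').
have [j ltj fj] := Yt _ (fY _ Aa').
have : (i < j)%N by rewrite -tmono -fj -fa fmono //; apply: mem_set.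
rewrite ltnNge imax //; apply/asboolP; rewrite -fj; exact: fY.
Qed.

End WellOrder.

(** The sets T_e of the opening comment. *)
Definition last_acc_le {d : Order.disp_t} {K : orderType d} (C : K -> set K) (e : K) :
    set K :=
  [set b | [/\ cf_omega b, e < b & forall x, acc (C b) x -> x <= e]].

(** * Coherent club sequences *)

Section Coherent.
Context {d : Order.disp_t} {K : orderType d} (woK : well_order (<=%O : rel K)).
Variable C : K -> set K.
Hypothesis Cclub : forall a, club (C a) (below a).
Hypothesis Ccoh : forall a b, a < b -> acc (C b) a -> C b `&` below a = C a.

Lemma last_acc_le_nreflects e : ~ reflects (last_acc_le C e).
Proof.
move=> [a [X cfX ncX] [_ stat]].
have dira := cf_countably_directed woK cfX ncX.
(* Uncountable cofinality of [a] makes the accumulation points of [C a] above [y] a club, which T_e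
   must meet. *)
have hit y : y < a -> exists t, [/\ last_acc_le C e t, acc (C a) t, y < t & t < a].
  move=> ltya; have := club_acc woK (@initial_segment_below _ _ a) dira (Cclub a) ltya.
  by move=> /stat[t [[Tt lta] [acct ltyt]]]; exists t.
(* Directedness at the empty set only serves to find some [y < a]. *)
have [|y lty _] := dira set0 _ (countable0 _); first by [].
have [t [[_ ltet _] acct _ ltta]] := hit y lty.
have [u [[_ _ accle] accu lttu ltua]] := hit t ltta.
suff /accle : acc (C u) t by rewrite leNgt ltet.
rewrite -(Ccoh ltua accu).
have [Ct zt /isLub_belowP lub] := acct; split=> //.
apply/isLub_belowP => z /lub[w Cw /andP[ltzw ltwt]]; exists w; last by rewrite ltzw.
by split=> //; apply: lt_trans lttu.
Qed.

Lemma limit_hits_last_acc_le E b : nonzero b -> club E [set: K] ->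
  isLub [set a | a < b /\ succ_omega (C b `\` below a) `<=` E] b ->
  exists e x, [/\ e < x, E x & last_acc_le C e x].
Proof.
move=> [i ltib] [_ Ecl] [_ lub].
have lim z : z < b -> exists a, [/\ z < a, a < b & succ_omega (C b `\` below a) `<=` E].
  move=> ltzb; apply: contrapT => nex; suff: b <= z by rewrite leNgt ltzb.
  apply: lub => a [ltab aE]; rewrite leNgt; apply/negP => ltza.
  by apply: nex; exists a.
have [[Cb Ccof] Ccl] := Cclub b.
have [a [_ ltab aE]] := lim i ltib.
pose D := C b `\` below a.
have Dabove x : x < b -> exists2 y, D y & x < y.
  move=> ltxb; have [|v [ltmv ltvb _]] := lim (Order.max x a); first by rewrite gt_max ltxb.
  move: ltmv; rewrite gt_max => /andP[ltxv ltav].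
  have [y Cy levy] := Ccof v ltvb; exists y; last exact: lt_le_trans levy.
  by split=> //; rewrite /below /= => ltya; have := lt_trans (lt_le_trans ltav levy) ltya;
    rewrite ltxx.
have [||s [Ds sS sP]] := @first_omega _ _ woK D.
- by have [y Dy _] := Dabove i ltib; exists y.
- by move=> x [/Cb ltxb _]; apply: Dabove.
have sb n : s n < b by have [/Cb] := Ds n.
have sE n : E (s n.+1) by apply/aE/succ_omega_first.
have [|x xs xmin] := @exists_min _ _ woK [set u | forall n, s n < u]; first by exists b.
have lexb : x <= b by apply: xmin.
have xcof z : z < x -> exists n, z <= s n.
  move=> ltzx; apply: contrapT => nex; suff: x <= z by rewrite leNgt ltzx.
  by apply: xmin => n; rewrite ltNge; apply/negP => lez; apply: nex; exists n.
have zx : nonzero x by exists (s 0%N).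
(* For [x = b] this is immediate; otherwise [x] is an accumulation point of [C b] and coherence
   applies. *)
have CxE : C x = C b `&` below x.
  move: lexb; rewrite le_eqVlt => /orP[/eqP->|ltxb]; first by apply/esym/setIidPl.
  apply/esym/Ccoh => //.
  have lubC : isLub (C b `&` below x) x.
    apply/isLub_belowP => z /xcof[n len]; exists (s n.+1); first by have [] := Ds n.+1.
    by rewrite (le_lt_trans len) //=.
  by split=> //; apply: Ccl.
exists (s 0%N), x; split=> //.
  apply: Ecl => //; apply/isLub_belowP => z /xcof[n len]; exists (s n.+1) => //.
  by rewrite (le_lt_trans len) //=.
split=> //; first exact: cf_omega_sup xcof.
(* Between [s 0] and [x], the elements of [C b] are the [s m]. So [y] would be some [s k.+1], with
   no element of [C b] between [s k] and [y], and could not be a limit. *)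
move=> y [+ _ /isLub_belowP luby]; rewrite CxE => -[Cby ltyx].
rewrite leNgt; apply/negP => lts0y.
have lea0 : a <= s 0%N by have [_ /negP] := Ds 0%N; rewrite -leNgt.
have DC w : C b w -> s 0%N <= w -> D w.
  by move=> Cw le0w; split=> //; apply/negP; rewrite -leNgt (le_trans lea0).
have [n len] := xcof y ltyx.
have [[//|k] _ yE] := sP n.+1 y (DC y Cby (ltW lts0y)) (le_lt_trans len (sS n)).
  by move: lts0y; rewrite yE ltxx.
have ltky : s k < y by rewrite yE.
have [w + /andP[ltkw ltwy]] := luby _ ltky; rewrite CxE => -[Cw _].
have smono := seq_mono_lt sS.
have le0w : s 0%N <= w by apply: le_trans (ltW ltkw); rewrite leNgt smono.
have ltws : w < s k.+1 by rewrite -yE.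
have [m ltm wE] := sP _ w (DC w Cw le0w) ltws.
by move: ltkw; rewrite wE smono ltnNge -ltnS ltm.
Qed.

End Coherent.

Theorem theorem1p14 (d : Order.disp_t) (K : orderType d)
    (hK : regular_uncountable_cardinal K) (hbox : boxtimes K) :
  ~ Refl (S_omega K).
Proof.
move=> refl; have [woK cardK ncK cfK] := hK; have [C [Cclub Ccoh hit]] := hbox.
have avoid e : exists E, club E [set: K] /\ ~ (last_acc_le C e `&` E !=set0).
  (* If T_e met every club it would be a stationary subset of [S_omega K], and [refl] would make it
     reflect. *)
  apply: contrapT => nex; apply: (last_acc_le_nreflects woK Cclub Ccoh (e := e)).
  apply: refl => [b []|] //; split=> // E clubE.
  by apply: contrapT => nTE; apply: nex; exists E.
have [E EP] := boolp.choice avoid.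
have bndK (a : K) (A : set K) : (A #<= below a)%card -> exists x, forall y, A y -> y < x.
  move=> leA; have [//||x _ xP] := cf_bounded woK cfK (A := A); last by exists x.
  by move=> KA; apply: (cardK a); apply: card_le_trans leA.
have clubD : club [set b | forall e, e < b -> E e b] [set: K].
  apply: (club_diagonal woK) => // [|e]; last by have [] := EP e.
  exact: cf_countably_directed cfK ncK.
(* Every A_i is taken to be the diagonal intersection; since [b] is nonzero, there is an index
   [i < b] to use. *)
have [b zb bP] := hit (fun=> _) (fun=> clubD.1); have [i ltib] := zb.
have [e [x [ltex Ex Tx]]] := limit_hits_last_acc_le woK Cclub Ccoh zb clubD (bP i ltib).
by have [_] := EP e; apply; exists x; split=> //; apply: Ex.
Qed.
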